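(* Let $k\ge 3$ and $s\geq 2k$ be integers, and let $\eta>0$. Then there exists a number $c=c(k,s,\eta)>0$ such that for every $A\ge 1$, the number of $\mathbf{a}\in(\mathbb{Z}\setminus\{0\})^s$ with $|\mathbf{a}|\leq A$ for which the equation $a_1x_1^k+\dots+a_sx_s^k=0$ admits an integral solution $\mathbf{x}\in\mathbb{Z}^s$ in the range $0<|\mathbf{x}|\leq c|\mathbf{a}|^{1/(s-k)}$ does not exceed $\eta A^s$.
   Context: $|\mathbf{x}|=\max_j|x_j|$, and similarly for $\mathbf{a}$. *)

(* Defs.v *)
From HB Require Import structures.
From mathcomp Require Import all_boot all_order all_algebra.
From mathcomp Require Import reals exp.
Set Implicit Arguments. Unset Strict Implicit. Unset Printing Implicit Defensive.
Import Order.TTheory GRing.Theory Num.Theory.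
Local Open Scope ring_scope.

Definition supn (s : nat) (v : {ffun 'I_s -> int}) : int :=
  \big[Num.max/0]_(i < s) `|v i|.

Definition diag_form (k s : nat) (a x : {ffun 'I_s -> int}) : int :=
  \sum_(i < s) a i * x i ^+ k.

Definition counted (R : realType) (k s : nat) (c A : R)
    (a : {ffun 'I_s -> int}) : Prop :=
  [/\ forall i, a i != 0,
      (supn a)%:~R <= A &
      exists x : {ffun 'I_s -> int},
        [/\ 0 < supn x,
            (supn x)%:~R <= c * powR (supn a)%:~R (1 / (s - k)%:R)
          & diag_form k a x = 0]].

(* Main.v *)
(* Dividing a solution x by a common prime factor of its coordinates shortens
   it, so only primitive x matter.  For primitive x with |x| = X and X^k <= A,
   the hyperplane a_1 x_1^k + ... + a_s x_s^k = 0 contains O(A^(s-1) / X^k)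
   points a with |a| <= A.  As O(X^(s-1)) vectors x have |x| = X, summing over
   X <= B = c A^(1/(s-k)) yields O(A^(s-1) B^(s-k)) = O(c^(s-k) A^s); the
   condition s >= 2k ensures B^k <= A. *)

Require Import Defs.
From HB Require Import structures.
From mathcomp Require Import all_boot all_order all_algebra.
From mathcomp Require Import reals exp.
From mathcomp Require Import zify.
Import Order.TTheory GRing.Theory Num.Theory.
Local Open Scope ring_scope.

(** * Integer points of bounded height on a primitive hyperplane *)

Lemma bezout_family {I : finType} {b : I -> int} :
  \big[gcdn/0%N]_i `|b i|%N = 1%N -> exists u : I -> int, \sum_i u i * b i = 1.
Proof.
move=> b1.
suff [u Hu] : exists u : I -> int,
    \sum_i u i * b i = Posz (\big[gcdn/0%N]_i `|b i|%N) by exists u; rewrite Hu b1.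
apply: (big_ind (fun g : nat => exists u : I -> int, \sum_i u i * b i = Posz g)).
- by exists (fun=> 0); rewrite big1 // => i _; rewrite mul0r.
- move=> m p [u Hu] [v Hv]; have [e [f Hef]] := Bezoutz (Posz m) (Posz p).
  exists (fun i => e * u i + f * v i).
  rewrite -[RHS]Hef -Hu -Hv !mulr_sumr -big_split /=.
  by apply: eq_bigr => i _; rewrite mulrDl !mulrA.
- move=> i _; exists (fun j => if j == i then sgz (b i) else 0).
  rewrite (bigD1 i) //= eqxx big1 ?addr0 => [|j /negPf ->]; last by rewrite mul0r.
  by rewrite -abszEsg.
Qed.

(* Put m = |b j| and choose u with u.b = 1.  Modulo m, the dot product with b of
   the shift a + (t u mod m), read off the coordinates other than j, equals t.
   So t < m, and then a, is recovered from these n coordinates, which all lie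
   in an interval of 3N + 1 integers. *)
Lemma count_hyperplane (n N : nat) (j : 'I_n.+1) (b : 'I_n.+1 -> int)
    (L : seq {ffun 'I_n.+1 -> int}) :
  \big[gcdn/0%N]_i `|b i|%N = 1%N -> b j != 0 -> (`|b j| <= N)%N -> uniq L ->
  (forall a, a \in L ->
     (forall i, `|a i| <= N)%N /\ \sum_i a i * b i = 0) ->
  (size L * `|b j| <= (3 * N).+1 ^ n)%N.
Proof.
move=> b1 bj0 bjN Lu HL; have [u Hu] := bezout_family b1.
set m := `|b j|%N in bjN *; have m0 : (0 < m)%N by rewrite /m absz_gt0.
pose w (t : 'I_m) i : int := ((Posz t * u i) %% Posz m)%Z.
have w_ge0 t i : 0 <= w t i by apply: modz_ge0; lia.
have w_lt t i : w t i < m by apply: ltz_pmod.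
(* Adding [N] makes the entries nonnegative and [w t i < m <= N] keeps them at most [3 * N], so
   neither the absolute value nor [inord] loses information. *)
pose f (a : {ffun 'I_n.+1 -> int}) (t : 'I_m) : {ffun 'I_n -> 'I_(3 * N).+1} :=
  [ffun i => inord `|a (lift j i) + Posz N + w t (lift j i)|].
have f_inj : {in [seq (a, t) | a <- L, t <- enum 'I_m] &, injective (uncurry f)}.
  move=> _ _ /allpairsP[[a t] /= [aL _ ->]] /allpairsP[[a' t'] /= [aL' _ ->]] /= ff.
  have [aN a_b] := HL _ aL; have [aN' a_b'] := HL _ aL'.
  have eq_shift i : a (lift j i) + w t (lift j i) = a' (lift j i) + w t' (lift j i).
    have := congr1 (fun h : {ffun 'I_n -> 'I_(3 * N).+1} => h i) ff.
    rewrite /f !ffunE => /(congr1 val) /=.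
    have := (aN (lift j i), aN' (lift j i)).
    move: (w_ge0 t (lift j i)) (w_lt t (lift j i)).
    move: (w_ge0 t' (lift j i)) (w_lt t' (lift j i)).
    move: (w t _) (w t' _) (a _) (a' _) => v v' x x' v'0 v'm v0 vm [xN x'N].
    rewrite !inordK; lia.
  (* The terms at [j] are multiples of [b j], so omitting them changes nothing modulo [m]; the rest
     follows from [u . b = 1]. *)
  have w_b s : (\sum_i w s (lift j i) * b (lift j i) = Posz s %[mod m])%Z.
    apply/eqP; rewrite eqz_mod_dvd -[X in _ - X]mulr1 -Hu mulr_sumr.
    rewrite [X in _ - X](bigD1_ord j) //= opprD addrCA -sumrB rpredD //.
      by rewrite rpredN mulrA dvdz_mull // dvdzE absz_nat /m.
    apply: rpred_sum => i _; rewrite mulrA -mulrBl dvdz_mulr //.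
    by rewrite -eqz_mod_dvd modz_mod.
  have b_a s : s \in L -> (\sum_i s (lift j i) * b (lift j i) = 0 %[mod m])%Z.
    move=> /HL[_]; rewrite (bigD1_ord j) //= => /eqP; rewrite addrC addr_eq0 => /eqP ->.
    by apply/eqP; rewrite eqz_mod_dvd subr0 rpredN dvdz_mull // dvdzE absz_nat /m.
  have dot_t s r : s \in L ->
      (\sum_i (s (lift j i) + w r (lift j i)) * b (lift j i) = Posz r %[mod m])%Z.
    move=> sL; under eq_bigr do rewrite mulrDl.
    by rewrite big_split /= -modzDm b_a // w_b modzDm add0r.
  have tt : t = t'.
    apply/val_inj; have : (Posz t = Posz t' %[mod m])%Z.
      rewrite -(dot_t _ _ aL) -(dot_t _ _ aL').
      by congr (_ %% _)%Z; apply: eq_bigr => i _; rewrite eq_shift.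
    by rewrite !modz_small ?ltz_nat ?ltn_ord //; case.
  have aa i : a (lift j i) = a' (lift j i).
    by have := eq_shift i; rewrite tt => /addIr.
  congr pair => //; apply/ffunP => i; case: (unliftP j i) => [i' -> // | ->].
  (* The remaining coordinate [a j] is forced by the hyperplane equation, since [b j] is nonzero. *)
  apply: (mulIf bj0); move: a_b a_b'; rewrite !(bigD1_ord j) //=.
  under eq_bigr do rewrite aa.
  by move=> e e'; apply: (addIr (\sum_i a' (lift j i) * b (lift j i))); rewrite e e'.
have /card_uniqP Hc : uniq [seq f a t | a <- L, t <- enum 'I_m].
  by apply: allpairs_uniq => //; apply: enum_uniq.
have := max_card (mem [seq f a t | a <- L, t <- enum 'I_m]).
by rewrite Hc size_allpairs size_enum_ord card_ffun !card_ord.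
Qed.

(** * Reduction to primitive, sign-normalised solutions *)

Lemma le_supn {s : nat} (v : {ffun 'I_s -> int}) i : `|v i| <= supn v.
Proof. by rewrite /supn; apply: (Order.TotalTheory.bigmax_sup i). Qed.

Lemma supn_attained {n : nat} (v : {ffun 'I_n.+1 -> int}) :
  exists j, supn v = `|v j|.
Proof.
have [|j _ vj] := @Order.TotalTheory.eq_bigmax _ int _ 0 (@ord0 n) xpredT
  (fun i => `|v i|) isT; first by move=> i _; apply: normr_ge0.
by exists j; apply: vj.
Qed.

(** Descent on the sup norm: a prime dividing every [x i ^ k] divides every [x i], and dividing it
    out preserves the homogeneous equation. Primitivity is stated for the powers because these are
    the coefficients of the hyperplane in [a]. *)
Lemma primitive_solution {k n : nat} {a x : {ffun 'I_n.+1 -> int}} :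
  (0 < k)%N -> 0 < supn x -> diag_form k a x = 0 ->
  exists y : {ffun 'I_n.+1 -> int},
    [/\ 0 < supn y, supn y <= supn x, diag_form k a y = 0
      & \big[gcdn/0%N]_i `|y i ^+ k|%N = 1%N].
Proof.
move=> k0; have [M] := ubnP `|supn x|%N.
elim: M x => // M IH x xM x0 ax.
have [g1|g1] := eqVneq (\big[gcdn/0%N]_i `|x i ^+ k|%N) 1%N; first by exists x.
have [p p_pr pg] : exists2 p, prime p & (p %| \big[gcdn/0%N]_i `|x i ^+ k|)%N.
  (* A zero gcd is divisible by any prime, so [2] serves there. *)
  case: (\big[gcdn/0%N]_i _) g1 => [|[|g]] // _; first by exists 2%N.
  by exists (pdiv g.+2); rewrite ?pdiv_prime ?pdiv_dvd.
have px i : (p %| x i)%Z.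
  rewrite dvdzE absz_nat; have /dvdn_biggcdP/(_ i isT) := pg.
  by rewrite abszX Euclid_dvdX // k0 andbT.
pose y : {ffun 'I_n.+1 -> int} := [ffun i => (x i %/ Posz p)%Z].
have xy i : x i = y i * p by rewrite ffunE divzK.
have p1 := prime_gt1 p_pr.
have y0 : 0 < supn y.
  have [j xj] := supn_attained x; apply: lt_le_trans (le_supn y j).
  by move: x0; rewrite xj !normr_gt0 xy mulf_eq0 negb_or => /andP[].
have yx : supn y < supn x.
  have [j yj] := supn_attained y; apply: lt_le_trans (le_supn x j).
  by rewrite yj xy normrM ltr_pMr -?yj // lez_nat.
have ay : diag_form k a y = 0.
  have /eqP : diag_form k a y * Posz p ^+ k = 0.
    rewrite -ax /diag_form mulr_suml; apply: eq_bigr => i _.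
    by rewrite xy exprMn mulrA.
  by rewrite mulf_eq0 expf_eq0 k0 eqz_nat -[p]prednK ?(ltnW p1) //= orbF => /eqP.
have [|z [z0 zy az gz]] := IH y _ y0 ay; first by lia.
by exists z; split=> //; apply: le_trans zy (ltW yx).
Qed.

(* The points with j-th coordinate X and sup norm X: up to sign, every vector of
   norm X has this form for some j. *)
Definition box_point {n : nat} (X : nat) (j : 'I_n.+1)
    (y : {ffun 'I_n -> 'I_(2 * X).+1}) : {ffun 'I_n.+1 -> int} :=
  [ffun i => if unlift j i is Some i' then Posz (y i') - Posz X else Posz X].

Definition primitive_zero {n : nat} (k X : nat) (j : 'I_n.+1)
    (y : {ffun 'I_n -> 'I_(2 * X).+1}) (a : {ffun 'I_n.+1 -> int}) : bool :=
  (\big[gcdn/0%N]_i `|box_point X j y i ^+ k|%N == 1%N)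
    && (diag_form k a (box_point X j y) == 0).

Lemma primitive_zero_exists {k n : nat} {a x : {ffun 'I_n.+1 -> int}} :
  (0 < k)%N -> 0 < supn x -> diag_form k a x = 0 ->
  exists X : nat, [/\ (0 < X)%N, Posz X <= supn x &
    exists j y, primitive_zero k X j y a].
Proof.
move=> k0 x0 ax; have [z [z0 zx az gz]] := primitive_solution k0 x0 ax.
have [j zj] := supn_attained z; exists `|z j|%N.
rewrite zj in z0 zx; split; [by lia | by lia | exists j].
(* Multiplying by the sign of [z j] makes the [j]-th coordinate positive; adding [|z j|] then moves
   the others into [0 .. 2 * |z j|]. The form only acquires the factor given by the [k]-th power of
   the sign. *)
pose y : {ffun 'I_n -> 'I_(2 * `|z j|).+1} :=
  [ffun i => inord `|(-1) ^+ (z j < 0)%R * z (lift j i) + Posz `|z j| |].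
have yz i : box_point `|z j|%N j y i = (-1) ^+ (z j < 0)%R * z i.
  rewrite ffunE; case: unliftP => [i' ->|->]; last by rewrite -abszEsign.
  have := le_supn z (lift j i'); rewrite zj ffunE => zi.
  have : `|(-1) ^+ (z j < 0)%R * z (lift j i')| = `|z (lift j i')|.
    by rewrite normrMsign.
  move: (_ * _) zi => t; move: (z _) (z j) => u v uv tu.
  by rewrite inordK; lia.
exists y; apply/andP; split.
  under eq_bigr do rewrite yz exprMn -exprM mulnC exprM abszM abszX.
  apply/eqP; rewrite -{}gz; apply: eq_bigr => i _.
  by rewrite abszX absz_sign !exp1n mul1n.
have -> : diag_form k a (box_point `|z j|%N j y)
    = (-1) ^+ (z j < 0)%R ^+ k * diag_form k a z.
  rewrite /diag_form mulr_sumr; apply: eq_bigr => i _.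
  by rewrite yz exprMn mulrCA.
by rewrite az mulr0.
Qed.

(** * Union bounds over solutions, and the choice of [c] *)

Lemma size_cover {T : Type} {I : finType} (P : I -> pred T) (L : seq T) :
  all (fun a => [exists i, P i a]) L ->
  (size L <= \sum_i size (filter (P i) L))%N.
Proof.
elim: L => [|a L IH] //= /andP[/existsP[i Pia] /IH {}IH].
apply: leq_ltn_trans IH _; rewrite (bigD1 i) //= [ltnRHS](bigD1 i) //= Pia /=.
rewrite ltnS leq_add2l; apply: leq_sum => j _.
by case: (P j a).
Qed.

(** There are [n.+1 * (2 * X).+1 ^ n] box points, and each primitive one annihilates at most
    [(3 * N).+1 ^ n / X ^ k] vectors, as its [j]-th power is [X ^ k]. The constant is [12 = 3 * 4],
    from [2 * X + 1 <= 3 * X] and [3 * N + 1 <= 4 * N]. *)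
Lemma count_box_point (k n X N : nat) (L : seq {ffun 'I_n.+1 -> int}) :
  (0 < k <= n)%N -> (0 < X)%N -> (X ^ k <= N)%N -> uniq L ->
  (forall a, a \in L -> forall i, `|a i| <= N)%N ->
  all (fun a => [exists jy : 'I_n.+1 * {ffun 'I_n -> 'I_(2 * X).+1},
    primitive_zero k X jy.1 jy.2 a]) L ->
  (size L <= n.+1 * 12 ^ n * N ^ n * X ^ (n - k))%N.
Proof.
move=> /andP[k0 kn] X0 XN Lu LN /size_cover LP.
have Xk0 : (0 < X ^ k)%N by rewrite expn_gt0 X0.
rewrite -(leq_pmul2r Xk0); apply: leq_trans (leq_mul LP (leqnn _)) _.
rewrite big_distrl /=.
apply: (@leq_trans (\sum_(jy : 'I_n.+1 * {ffun 'I_n -> 'I_(2 * X).+1}) (4 * N) ^ n)%N).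
  apply: leq_sum => -[j y] _ /=.
  (* Box points that are not primitive have an empty filter. *)
  have [g1|g1] :=
    eqVneq (\big[gcdn/0%N]_i `|box_point X j y i ^+ k|%N) 1%N; last first.
    rewrite (eq_filter (a2 := pred0)) ?filter_pred0 // => a.
    by rewrite /primitive_zero (negPf g1).
  have bj : box_point X j y j = Posz X by rewrite ffunE unlift_none.
  have bjk : `|box_point X j y j ^+ k|%N = (X ^ k)%N by rewrite bj abszX.
  rewrite -bjk; apply: (@leq_trans ((3 * N).+1 ^ n)); last by rewrite leq_exp2r; lia.
  apply: (@count_hyperplane n N j (fun i => box_point X j y i ^+ k)) => //.
  - by rewrite bj expf_eq0 eqz_nat; lia.
  - by rewrite bjk.
  - exact: filter_uniq.
  - move=> a; rewrite mem_filter => /andP[/andP[_ /eqP az] aL].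
    by split=> //; apply: LN.
rewrite sum_nat_const card_prod card_ord card_ffun !card_ord.
rewrite -!mulnA -expnD subnK // !mulnA -!mulnA leq_mul2l /= -!expnMn leq_exp2r; last by lia.
nia.
Qed.

Lemma count_solvable (k n B N : nat) (L : seq {ffun 'I_n.+1 -> int}) :
  (0 < k <= n)%N -> (B ^ k <= N)%N -> uniq L ->
  (forall a, a \in L -> forall i, `|a i| <= N)%N ->
  (forall a, a \in L -> exists x : {ffun 'I_n.+1 -> int},
     [/\ 0 < supn x, supn x <= Posz B & diag_form k a x = 0]) ->
  (size L <= n.+1 * 12 ^ n * N ^ n * B ^ (n.+1 - k))%N.
Proof.
move=> kn BN Lu LN Lx; have /andP[k0 k_le_n] := kn.
(* The index [X] in ['I_B] stands for the norm [X.+1], so the norms run over [1 .. B]. *)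
pose P (X : 'I_B) (a : {ffun 'I_n.+1 -> int}) :=
  [exists jy : 'I_n.+1 * {ffun 'I_n -> 'I_(2 * X.+1).+1},
     primitive_zero k X.+1 jy.1 jy.2 a].
have /(size_cover P) LP : all (fun a => [exists X, P X a]) L.
  apply/allP => a /Lx[x [x0 xB ax]].
  have [[|X] [// X0 Xx [j [y jya]]]] := primitive_zero_exists k0 x0 ax.
  have XB : (X < B)%N by rewrite -lez_nat (le_trans Xx).
  by apply/existsP; exists (Ordinal XB); apply/existsP; exists (j, y).
apply: leq_trans LP _.
apply: (@leq_trans (\sum_(X < B) n.+1 * 12 ^ n * N ^ n * B ^ (n - k))%N); last first.
  by rewrite sum_nat_const card_ord subSn // expnS mulnCA.
apply: leq_sum => X _.
apply: (@leq_trans (n.+1 * 12 ^ n * N ^ n * X.+1 ^ (n - k))).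
  apply: count_box_point => //.
  - by apply: leq_trans BN; rewrite leq_exp2r.
  - exact: filter_uniq.
  - by move=> a; rewrite mem_filter => /andP[_]; apply: LN.
  - exact: filter_all.
rewrite leq_mul2l; apply/orP; right.
by case: (n - k)%N => [|e]; rewrite ?expn0 ?leq_exp2r.
Qed.

(* "the number of counted a does not exceed eta A^s" is stated as: every
   duplicate-free list of counted vectors has length <= eta A^s. *)
Theorem theorem1p4 (R : realType) (k s : nat) (eta : R) :
  (3 <= k)%N -> (2 * k <= s)%N -> 0 < eta ->
  exists c : R, 0 < c /\
    forall A : R, 1 <= A ->
      forall L : seq {ffun 'I_s -> int}, uniq L ->
        (forall a, a \in L -> counted k c A a) ->
        (size L)%:R <= eta * A ^+ s.
Proof.
case: s => [|n] k3 ks eta0; first by lia.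
pose C : nat := (n.+1 * 12 ^ n)%N.
have C0 : 0 < C%:R :> R by rewrite ltr0n muln_gt0 expn_gt0.
(* The bound [c <= 1] yields [c ^+ m <= c] and [B ^ k <= N]; the bound [C * c <= eta] gives the
   final estimate. *)
pose c : R := Num.min 1 (eta / C%:R).
have c0 : 0 < c by rewrite lt_min ltr01 divr_gt0.
have c1 : c <= 1 by rewrite ge_min lexx.
have cC : C%:R * c <= eta by rewrite mulrC -ler_pdivlMr // ge_min lexx orbT.
exists c; split=> // A A1 L Lu LA.
have A0 : 0 <= A := le_trans ler01 A1.
have [m_gt0 k_le] : (0 < n.+1 - k)%N /\ (k <= n.+1 - k)%N by lia.
set m := (n.+1 - k)%N in m_gt0 k_le *.
pose r : R := A `^ (1 / m%:R).
have r0 : 0 <= r := powR_ge0 _ _.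
have rm : r ^+ m = A.
  by rewrite -powR_mulrn // -powRrM div1r mulVf ?powRr1 // pnatr_eq0 -lt0n.
have cr0 : 0 <= c * r by rewrite mulr_ge0 // ltW.
pose N := Num.truncn A; pose B := Num.truncn (c * r).
have NA : N%:R <= A by rewrite -truncn_ge_nat.
have Bcr : B%:R <= c * r by rewrite -truncn_ge_nat.
have Bm : (B%:R : R) ^+ m <= c * A.
  apply: (le_trans (y := (c * r) ^+ m)); first by rewrite lerXn2r // nnegrE.
  rewrite exprMn rm ler_wpM2r // -[m]prednK // exprS ger_pMr //.
  by rewrite exprn_ile1 // ltW.
(* Here [2 * k <= s] enters, as [k <= m]: for [B >= 1], [B ^ k <= B ^ m <= c * A <= A]. *)
have BN : (B ^ k <= N)%N.
  rewrite /N truncn_ge_nat // natrX.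
  have [->|B0] := posnP B; first by rewrite expr0n gtn_eqF ?(ltnW (ltnW k3)).
  apply: (le_trans (y := (B%:R : R) ^+ m)); first by rewrite ler_weXn2l // ler1n.
  by apply: le_trans Bm _; rewrite ger_pMl // (lt_le_trans ltr01).
have := @count_solvable k n B N L.
have -> : (0 < k <= n)%N by lia.
move=> /(_ isT BN Lu) HL.
have {HL} : (size L <= C * N ^ n * B ^ m)%N.
  apply: HL => a /LA[_ aA [x [x0 xc ax]]].
    move=> i; rewrite /N truncn_ge_nat //; apply: le_trans aA.
    by rewrite -[_%:R]/((Posz `|a i|)%:~R) ler_int abszE le_supn.
  exists x; split=> //.
  have -> : supn x = Posz `|supn x| by rewrite abszE gtr0_norm.
  rewrite lez_nat /B truncn_ge_nat //.
  rewrite -[_%:R]/((Posz `|supn x|)%:~R) abszE gtr0_norm //.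
  (* Since [supn a <= A], monotonicity of the power replaces the range depending on [a] by the
     uniform bound [c * r]. *)
  apply: le_trans xc _; rewrite ler_wpM2l ?(ltW c0) //.
  have a0 : 0 <= supn a := le_trans (normr_ge0 _) (le_supn a ord0).
  by apply: ge0_ler_powR; rewrite ?nnegrE ?ler0z ?divr_ge0.
rewrite -(ler_nat R) 2!natrM [(N ^ n)%:R]natrX [(B ^ m)%:R]natrX.
move=> /le_trans; apply.
apply: (le_trans (y := C%:R * A ^+ n * (c * A))).
  apply: ler_pM => //; rewrite ?mulr_ge0 ?exprn_ge0 ?ler0n //.
  by rewrite ler_wpM2l ?(ltW C0) // lerXn2r // nnegrE.
by rewrite mulrACA -exprSr ler_wpM2r ?exprn_ge0.
Qed.
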